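(* Every $\sigma$-compact locally compact cancellative commutative topological monoid with open shifts has countable cellularity.
   Context: No separation axiom is assumed. A topological monoid is a monoid $S$ with a topology such that the operation $S\times S\to S$ is jointly continuous. It has open shifts if for every $a\in S$ and every open $U\subseteq S$ the sets $aU$ and $Ua$ are open in $S$. A space is locally compact if each point has a compact neighborhood (compactness does not include Hausdorffness here), and $\sigma$-compact if it is a countable union of compact subsets. A cellular family in a space $X$ is a nonempty pairwise disjoint family of nonempty open sets in $X$; the cellularity is $c(X)=\sup\{|\mathcal U|:\mathcal U\text{ is a cellular family in }X\}+\aleph_0$, and $X$ has countable cellularity if $c(X)=\aleph_0$. *)

(* Defs.v *)
From mathcomp Require Import all_boot all_algebra.
From mathcomp Require Import boolp classical_sets functions cardinality.
From mathcomp Require Import topology tvs.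

Set Implicit Arguments.
Unset Strict Implicit.
Unset Printing Implicit Defensive.

Import GRing.Theory.

Local Open Scope classical_set_scope.
Local Open Scope ring_scope.
Local Open Scope card_scope.

(* [TopologicalNmodule.type] is the library's type of commutative topological
   monoids: its operation is written additively and is jointly continuous, and
   no separation axiom is assumed.  Thus the shifts aU and Ua are written
   [a + U] and [U + a]. *)

Definition cancellative (S : nmodType) : Prop :=
  right_injective (+%R : S -> S -> S) /\ left_injective (+%R : S -> S -> S).

Definition open_shifts (S : TopologicalNmodule.type) : Prop :=
  forall (a : S) (U : set S), open U ->
    open [set a + x | x in U] /\ open [set x + a | x in U].

(* The library's [locally_compact] asks for closed compact neighborhoods, which
   is stronger in the absence of the Hausdorff property. *)
Definition has_compact_nbhs (X : topologicalType) : Prop :=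
  forall x : X, exists2 K : set X, nbhs x K & compact K.

Definition sigma_compact (X : topologicalType) : Prop :=
  exists2 K : nat -> set X,
    forall n, compact (K n) & \bigcup_n K n = [set: X].

Definition cellular_family (X : topologicalType) (U : set (set X)) : Prop :=
  [/\ U !=set0, trivIset U id & forall A, U A -> open A /\ A !=set0].

(* Cardinals are represented by types, up to bijection: [is_card_sup F K] says
   that the cardinal |K| is the supremum of {|U| : U in F}. *)
Definition is_card_sup (T : Type) (F : set (set T)) (K : Type) : Prop :=
  (forall U, F U -> U #<= [set: K]) /\
  (forall L : Type, (forall U, F U -> U #<= [set: L]) -> [set: K] #<= [set: L]).

(* The disjoint sum with [nat] is the cardinal sum with aleph_0. *)
Definition is_cellularity (X : topologicalType) (K : Type) : Prop :=
  exists2 M : Type,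
    is_card_sup (@cellular_family X) M & [set: K] #= [set: (M + nat)%type].

Definition countable_cellularity (X : topologicalType) : Prop :=
  is_cellularity X nat.

(* Main.v *)
Require Import Defs.
From HB Require Import structures.
From mathcomp Require Import all_boot all_algebra.
From mathcomp Require Import boolp classical_sets functions cardinality.
From mathcomp Require Import topology tvs.
From mathcomp Require Import zify ring.

(** For a locally compact abelian group the statement would follow from Haar
    measure: open subsets of a compact set have positive measure, so at most
    countably many can be disjoint. Here addition need not extend to a
    topological group structure (inversion may be discontinuous and points
    need not be separated), but the elementary comparison underlying Haar
    measure survives: if [C] is nonempty and contains [m] disjoint sets, each
    of which has [n] translates covering [C], then [m <= n]
    ([packing_le_covering]). The reason is algebraic, namely the polynomial
    growth of abelian groups: if [m] were larger than [n], moving points of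
    [C] along the covering translates would reach, after [t] steps, at least
    [(m / n) ^ t] different points, while by commutativity the reachable points
    number at most [(t + 1) ^ (m * n)]; this is absurd for large [t]
    ([expn_growth]).

    The translates by differences [k - u] are formed inside the monoid, as the
    sets of [x] with [x + u] in [k + U]; they are open because shifts are open
    and addition is continuous. So every nonempty open set has finitely many
    translates covering a given compact set ([compact_covers_with]). Now fix a
    cellular family. Countably many interiors of compact sets cover the
    monoid, every member of the family meets one of these interiors, and for
    each of the chosen compact sets [C] and each [n], at most [n] members meet
    the interior of [C] in a set with [n] translates covering [C]. Hence the
    family is countable ([cellular_countable]). It remains to see that a
    family of countable cardinals has a countable supremum ([countable_sup]). *)

Import GRing.Theory.
Local Open Scope classical_set_scope.

(** * Exponentials outgrow polynomials *)

(** Bernoulli's inequality for [(1 + 1/n) ^ k], with denominators cleared. *)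
Lemma leq_expn_succ (n k : nat) : n ^ k * (n + k) <= n * n.+1 ^ k.
Proof.
elim: k => [|k IHk]; first by rewrite !expn0 addn0 mul1n muln1.
rewrite [n ^ _]expnSr [n.+1 ^ _]expnSr mulnA.
apply: leq_trans (leq_mul IHk (leqnn n.+1)).
rewrite -!mulnA leq_mul2l; apply/orP; right; nia.
Qed.

(** Since [(1 + 1/n) ^ n >= 2] for [n > 0], it suffices to find [s] with
    [(n * s + 1) ^ e < 2 ^ s] and to put [t = n * s]. *)
Lemma expn_growth (n e : nat) : exists t, n ^ t * t.+1 ^ e < n.+1 ^ t.
Proof.
case: (posnP n) => [->|n_gt0]; first by exists 1; rewrite exp0n // exp1n.
(* With [s] a power of 2 the inequality becomes a comparison of exponents,
   [(n + 2 * q) * e < 2 ^ (2 * q)], which follows from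
   [n + 2 * q <= 3 * q] and [3 * e <= q]. *)
pose q := 3 * (n + e); pose s := 2 ^ (q + q).
exists (n * s).
have two_le : 2 * n ^ n <= n.+1 ^ n.
  rewrite -(leq_pmul2l n_gt0); apply: leq_trans (leq_expn_succ n n).
  by rewrite addnn -mul2n; apply/eq_leq; ring.
have poly_lt : (n * s).+1 ^ e < 2 ^ s.
  have base_le : (n * s).+1 <= 2 ^ (n + (q + q)).
    rewrite expnD -/s; apply: (@leq_trans (n.+1 * s)).
      by rewrite mulSn -addn1 addnC leq_add2r expn_gt0.
    by rewrite leq_mul2r ltn_expl ?orbT.
  apply: (@leq_ltn_trans (2 ^ ((n + (q + q)) * e))).
    by rewrite expnM; case: (e) => // e'; rewrite leq_exp2r.
  rewrite ltn_exp2l // /s expnD.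
  have q_lt : q < 2 ^ q by apply: ltn_expl.
  apply: (@leq_ltn_trans (q * q)); last by rewrite ltn_mul.
  rewrite /q; nia.
apply: (@leq_trans (2 ^ s * n ^ (n * s))).
  by rewrite mulnC ltn_pmul2r ?expn_gt0 ?n_gt0.
by rewrite !expnM -expnMn leq_exp2r // expn_gt0.
Qed.

Local Open Scope ring_scope.
Local Open Scope card_scope.

(** * Packings and coverings by translates in a commutative monoid *)

(** The part lying in the monoid of the translate of [U] by [k - u], which is
    taken in the group of differences. *)
Definition translate_of {S : nmodType} (U : set S) (u k : S) : set S :=
  [set x | exists2 y, U y & x + u = k + y].

Definition covers_with {S : nmodType} (n : nat) (C U : set S) : Prop :=
  exists u : S, exists k : 'I_n -> S, C `<=` \bigcup_j translate_of U u (k j).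

(** The point [foldr f x0 w] is reached from [x0] by performing the moves of [w],
    last letter first.  The trace lists the letters of [w], each with the
    label that [g] gives to the move at the point where it is performed. *)
Fixpoint trace {S : Type} {m n : nat} (f : 'I_m -> S -> S)
    (g : 'I_m -> S -> 'I_n) (x0 : S) (w : seq 'I_m) : seq ('I_m * 'I_n) :=
  if w is i :: w' then (i, g i (foldr f x0 w')) :: trace f g x0 w' else [::].

Lemma size_trace {S : Type} {m n : nat} (f : 'I_m -> S -> S)
    (g : 'I_m -> S -> 'I_n) (x0 : S) (w : seq 'I_m) :
  size (trace f g x0 w) = size w.
Proof. by elim: w => //= i w ->. Qed.

(** If the move [i] with label [j] shifts points by [u i - k i j], the end point
    of a path depends only on how often each pair [(i, j)] occurs in its trace:
    this is where commutativity enters, and it leaves only polynomially many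
    end points for paths of a given length. *)
Lemma trace_sum {S : nmodType} {m n : nat} (C : set S) (u : 'I_m -> S)
    (k : 'I_m -> 'I_n -> S) (f : 'I_m -> S -> S) (g : 'I_m -> S -> 'I_n) (x0 : S)
    (fC : forall i x, C x -> C (f i x))
    (stepE : forall i x, C x -> x + u i = k i (g i x) + f i x)
    (w : seq 'I_m) : C x0 ->
  C (foldr f x0 w) /\
  x0 + \sum_(p <- trace f g x0 w) u p.1
    = foldr f x0 w + \sum_(p <- trace f g x0 w) k p.1 p.2.
Proof.
move=> Cx0; elim: w => [|i w [Cw IHw]] /=; first by rewrite !big_nil.
split; first exact: fC.
rewrite !big_cons /= addrCA IHw addrA [u i + _]addrC stepE //.
by rewrite [RHS]addrCA addrA.
Qed.

(** A path can be read backwards: its end point lies in [U i] for only one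
    letter [i], hence reveals the last move, and together with the label of this
    move it determines the previous point by cancellation. *)
Lemma trace_inj {S : nmodType} (hcancel : cancellative S) {m n : nat} (C : set S)
    (U : 'I_m -> set S) (u : 'I_m -> S)
    (k : 'I_m -> 'I_n -> S) (f : 'I_m -> S -> S) (g : 'I_m -> S -> 'I_n) (x0 : S)
    (trivU : trivIset setT U)
    (fU : forall i x, C x -> U i (f i x))
    (stepE : forall i x, C x -> x + u i = k i (g i x) + f i x)
    (inC : forall w, C (foldr f x0 w))
    (w w' : seq 'I_m) : size w = size w' ->
  foldr f x0 w = foldr f x0 w' ->
  [seq p.2 | p <- trace f g x0 w] = [seq p.2 | p <- trace f g x0 w'] ->
  w = w'.
Proof.
elim: w w' => [|i w IHw] [|i' w'] //= [sz] fE [gE tE].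
have ii' : i = i'.
  apply: trivU => //; exists (f i (foldr f x0 w)).
  by split; [exact: fU | rewrite fE; exact: fU].
subst i'; congr (_ :: _); apply: IHw => //.
apply: (hcancel.2 (u i)).
by rewrite !stepE // fE gE.
Qed.

(** A substitute for the volume comparison behind Haar measure.  For every word
    over ['I_m], start at a point of [C] and let the letter [i] move the current
    point [x] to a point of [U i] that lies in the translate covering [x],
    labelled by the index [j] of this translate.  A word is determined by its
    labels and its end point, and the end point by the numbers of occurrences of
    the pairs [(i, j)], so [m ^ t <= n ^ t * (t + 1) ^ (m * n)] for all [t], which
    forces [m <= n]. *)
Lemma packing_le_covering {S : nmodType} (hcancel : cancellative S) {m n : nat}
    (C : set S) (U : 'I_m -> set S) (C0 : C !=set0)
    (UC : forall i, U i `<=` C) (trivU : trivIset setT U)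
    (coverU : forall i, covers_with n C (U i)) :
  (m <= n)%N.
Proof.
rewrite leqNgt; apply/negP => n_lt_m; case: C0 => x0 Cx0.
have /choice[uk coverUk] (i : 'I_m) : exists uk : S * ('I_n -> S),
    C `<=` \bigcup_j translate_of (U i) uk.1 (uk.2 j).
  by have [u [k ukC]] := coverU i; exists (u, k).
pose u i := (uk i).1; pose k i := (uk i).2.
have [j0 _ _] := coverUk (Ordinal (leq_ltn_trans (leq0n n) n_lt_m)) x0 Cx0.
(* Outside [C] the moves take arbitrary values, with label [j0]. *)
have /choice[h hP] (p : 'I_m * S) : exists jy : 'I_n * S, C p.2 ->
    U p.1 jy.2 /\ p.2 + u p.1 = k p.1 jy.1 + jy.2.
  have [Cp|nCp] := pselect (C p.2); last by exists (j0, p.2) => /nCp.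
  by have [j _ [y Uy E]] := coverUk p.1 _ Cp; exists (j, y).
pose f i x := (h (i, x)).2; pose g i x := (h (i, x)).1.
have fU i x : C x -> U i (f i x) by move=> Cx; have [] := hP (i, x) Cx.
have stepE i x : C x -> x + u i = k i (g i x) + f i x.
  by move=> Cx; have [] := hP (i, x) Cx.
have fC i x (Cx : C x) := UC i _ (fU i x Cx).
have sumE w := trace_sum C u k f g x0 fC stepE w Cx0.
have [t] := expn_growth n #|{: 'I_m * 'I_n}|.
rewrite ltnNge => /negP; apply.
have size_snd (w : t.-tuple 'I_m) : size [seq p.2 | p <- trace f g x0 w] == t.
  by rewrite size_map size_trace size_tuple.
(* A trace of length [t] contains a pair at most [t] times, so the counts fit
   into ['I_t.+1] and [inord] does not truncate them. *)
pose cnt (w : t.-tuple 'I_m) :=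
  [ffun p => inord (count_mem p (trace f g x0 w)) : 'I_t.+1].
pose code (w : t.-tuple 'I_m) := (Tuple (size_snd w), cnt w).
have code_inj : injective code.
  move=> w w' [sndE cntE]; apply/val_inj => /=.
  have : perm_eq (trace f g x0 w) (trace f g x0 w').
    apply/allP => p _ /=; have /ffunP/(_ p) := cntE.
    have cnt_le (v : t.-tuple 'I_m) : (count_mem p (trace f g x0 v) < t.+1)%N.
      by rewrite ltnS (leq_trans (count_size _ _)) // size_trace size_tuple.
    by rewrite !ffunE => /(congr1 val) /=; rewrite !inordK // => ->.
  move=> perm_tr.
  have [Cw Ew] := sumE w; have [Cw' Ew'] := sumE w'.
  apply: (trace_inj hcancel C U u k f g x0) => //.
  - by move=> v; have [] := sumE v.
  - by rewrite !size_tuple.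
  apply: (hcancel.2 (\sum_(p <- trace f g x0 w) k p.1 p.2)).
  by rewrite -Ew (perm_big _ perm_tr) Ew' (perm_big _ perm_tr).
apply: (@leq_trans (m ^ t)); first by case: (t) => // t'; rewrite leq_exp2r.
have := leq_card code code_inj.
by rewrite card_prod !card_tuple card_ffun !card_ord.
Qed.

(** * Countability of cellular families *)

(** The base point turns [X] into a pointed space, for which compactness is known
    to be equivalent to the finite subcover property. *)
Lemma compact_finite_cover {X : topologicalType} (x0 : X) (C : set X)
    (I : choiceType) (D : set I) (W : I -> set X) :
  compact C -> (forall i, D i -> open (W i)) -> C `<=` \bigcup_(i in D) W i ->
  exists2 s : seq I, {subset s <= D} & C `<=` \bigcup_(i in [set` s]) W i.
Proof.
pose X' := HB.pack_for ptopologicalType X (isPointed.Build X x0).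
move=> cC oW CW; move: (cC); rewrite -[compact C]/(@compact X' C).
rewrite compact_cover => /(_ I D W oW CW)[s sD Cs].
by exists (finmap.enum_fset s).
Qed.

(** The translate of [U] by [k - u] with [u] in [U] contains [k], so the
    translates for [k] in [C] cover [C]; each is open, as the preimage of the open
    shift of [U] by [k] under the continuous addition of [u]. *)
Lemma compact_covers_with {S : TopologicalNmodule.type} (hshift : open_shifts S)
    (C U : set S) :
  compact C -> open U -> U !=set0 -> exists n, covers_with n C U.
Proof.
move=> cC oU [u Uu].
have oT k : open (translate_of U u k).
  have -> : translate_of U u k = (fun x => x + u) @^-1` [set k + y | y in U].
    by apply/seteqP; split=> x /= [y Uy E]; exists y.
  apply: open_comp => [x _|]; last by have [] := hshift k U oU.
  apply: (@cvg_comp _ _ _ (fun y : S => (y, u)) (fun z : S * S => z.1 + z.2)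
    (nbhs x) (nbhs (x, u))); last exact: (@add_continuous S (x, u)).
  by apply: cvg_pair; [exact: cvg_id | exact: cvg_cst].
have [|s _ Cs] := compact_finite_cover (0 : S) C S C
    (translate_of U u) cC (fun k _ => oT k).
  by move=> k Ck; exists k => //; exists u.
exists (size s), u, (fun j => nth 0 s j) => x /Cs[k /= ks xk].
have ks' : (index k s < size s)%N by rewrite index_mem.
by exists (Ordinal ks') => //=; rewrite nth_index.
Qed.

(** In fact there are at most [n] such sets, by comparing the packing of [C] by
    their intersections with [W] with the coverings of [C]. *)
Lemma finite_covering_cells {S : nmodType} (hcancel : cancellative S) (n : nat)
    (C W : set S) (F : set (set S)) :
  W `<=` C -> trivIset F id ->
  finite_set [set A | F A /\ A `&` W !=set0 /\ covers_with n C (A `&` W)].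
Proof.
move=> WC trivF; apply: contrapT => /infiniteP/pcard_leP/injfunPex[/= A AF Ainj].
have {}AF i : F (A i) /\ A i `&` W !=set0 /\ covers_with n C (A i `&` W).
  exact: AF.
suff : (n.+1 <= n)%N by rewrite ltnn.
apply: (packing_le_covering hcancel C (fun i => A (val i) `&` W)).
- by have [_ [[x [_ /WC Cx]] _]] := AF 0%N; exists x.
- by move=> i x [_ /WC].
- move=> i j _ _ [x [[Ax _] [Ax' _]]]; apply/val_inj/Ainj; rewrite ?inE //.
  by apply: (trivF (A i) (A j)); [exact: (AF i).1 | exact: (AF j).1 | exists x].
- by move=> i; have [_ []] := AF i.
Qed.

(** By sigma-compactness countably many of the interiors of compact
    neighborhoods cover [S].  Every member of [F] meets one of them, and
    finitely many translates of the intersection cover the compact neighborhood,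
    so [F] is a countable union of the finite families of
    [finite_covering_cells]. *)
Lemma cellular_countable {S : TopologicalNmodule.type}
    (hcancel : cancellative S) (hshift : open_shifts S)
    (hsigma : sigma_compact S) (hlc : has_compact_nbhs S) (F : set (set S)) :
  cellular_family F -> countable F.
Proof.
case=> _ trivF openF; case: hsigma => K cK KT.
have /choice[N NP] (x : S) : exists N : set S, nbhs x N /\ compact N.
  by have [N Nx cN] := hlc x; exists N.
have /choice[s sP] (l : nat) : exists s : seq S,
    K l `<=` \bigcup_(x in [set` s]) interior (N x).
  have [||s _ Ks] := compact_finite_cover (0 : S) (K l) S setT
    (fun x => interior (N x)) (cK l).
  - by move=> x _; exact: open_interior.
  - by move=> x _; exists x => //; exact: (NP x).1.
  by exists s.
pose cells x n := [set A | F A /\ A `&` interior (N x) !=set0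
  /\ covers_with n (N x) (A `&` interior (N x))].
apply: (@sub_countable _ _ _
  (\bigcup_l \bigcup_(x in [set` s l]) \bigcup_n cells x n)); last first.
  apply: bigcup_countable => // l _; apply: bigcup_countable => [|x _].
    exact/finite_set_countable/finite_seq.
  apply: bigcup_countable => // n _; apply: finite_set_countable.
  apply: finite_covering_cells => //; exact: interior_subset.
apply: subset_card_le => A FA; have [oA [a Aa]] := openF A FA.
have [l _ Kla] : (\bigcup_n K n) a by rewrite KT.
have [x sx xa] := sP l a Kla.
have AW0 : A `&` interior (N x) !=set0 by exists a.
have [n nP] := compact_covers_with hshift (N x) _ (NP x).2
  (openI oA (open_interior (N x))) AW0.
by exists l => //; exists x => //; exists n.
Qed.

(** * Suprema of countable cardinals *)

(** The supremum is the least uniform finite bound if there is one, and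
    otherwise [nat]: a type [L] bounding all members of [F] is then infinite. *)
Lemma countable_sup {T : Type} (F : set (set T)) :
  (forall U, F U -> countable U) ->
  exists2 M : Type, is_card_sup F M & countable [set: M].
Proof.
move=> cF; have [bF|nbF] := pselect (exists n, forall U, F U -> U #<= `I_n).
  pose P n := `[< forall U, F U -> U #<= `I_n >].
  have exP : exists n, P n by have [n nP] := bF; exists n; apply/asboolP.
  case: (ex_minnP exP) => n /asboolP nP nmin.
  exists 'I_n; last exact: countableP.
  split=> [U FU|L LP]; first by rewrite -(card_le_eqr card_II); exact: nP.
  rewrite -(card_le_eql card_II);
  have [|/infiniteP] := pselect (finite_set [set: L]).
    move=> /finite_setP[p Lp]; rewrite (card_le_eqr Lp) card_le_II.
    apply/nmin/asboolP => U FU; rewrite -(card_le_eqr Lp); exact: LP.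
  by apply: card_le_trans; exact: countableP.
exists nat => //; split=> [U /cF //|L LP].
apply/infiniteP => /finite_setP[n Ln]; apply: nbF; exists n => U FU.
by rewrite -(card_le_eqr Ln); exact: LP.
Qed.

Theorem corollary4p2 (S : TopologicalNmodule.type)
    (hcancel : cancellative S) (hshift : open_shifts S)
    (hsigma : sigma_compact S) (hlc : has_compact_nbhs S) :
  countable_cellularity S.
Proof.
have [|M supM cM] := @countable_sup (set S) (@cellular_family S).
  by move=> F; exact: cellular_countable.
exists M => //; rewrite card_eq_sym; apply: eq_card_nat.
  by have [M' ->] := Pcountable cM; exact: countableP.
apply/infiniteP.
have inrI : {in [set: nat] &, injective (@inr M nat)} by move=> x y _ _ [].
by rewrite -(card_le_eql (inj_card_eq inrI)); exact: card_leT.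
Qed.
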